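(* Let $k$ be a commutative ring and suppose that $A$ and $B$ are two $k$-algebras which, as rings, are weakly $2$-primal periodic rings. Then $A\otimes_k B$ is a periodic $k$-algebra (i.e., it is periodic as a ring).
   Context: All rings and algebras are associative with identity (not necessarily commutative unless stated). A ring $R$ is periodic if for every $x\in R$ there exist distinct positive integers $m\neq n$ with $x^m=x^n$. $\mathrm{Nil}(R)$ denotes the set of nilpotent elements of $R$, and the Levitzki radical $L\text{-}rad(R)$ is the largest locally nilpotent two-sided ideal of $R$ (an ideal is locally nilpotent if for every finite subset of it there is a natural number $N$ such that every product of $N$ elements from this subset is zero). $R$ is weakly $2$-primal if $\mathrm{Nil}(R)=L\text{-}rad(R)$. *)

(* Defs.v *)
From HB Require Import structures.
From mathcomp Require Import all_boot all_algebra.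
From mathcomp Require Import boolp classical_sets.

Set Implicit Arguments.
Unset Strict Implicit.
Unset Printing Implicit Defensive.

Import GRing.Theory.
Local Open Scope ring_scope.
Local Open Scope quotient_scope.
Local Open Scope classical_set_scope.

Section RingNotions.
Variable R : pzRingType.

Definition periodic : Prop :=
  forall x : R, exists m n : nat,
    [/\ (0 < m)%N, (0 < n)%N, m <> n & x ^+ m = x ^+ n].

Definition Nil : set R := [set x | exists n : nat, x ^+ n = 0].

Definition two_sided_ideal (I : set R) : Prop :=
  [/\ I 0, (forall x y, I x -> I y -> I (x - y)),
      (forall a x, I x -> I (a * x)) & (forall a x, I x -> I (x * a))].

(* Products need not be of distinct elements: w ranges over words of length N
   with letters in the finite subset listed by F. *)
Definition locally_nilpotent (I : set R) : Prop :=
  forall F : seq R, (forall x, x \in F -> I x) ->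
    exists N : nat, forall w : N.-tuple R,
      {subset w <= F} -> \prod_(x <- w) x = 0.

Definition is_Levitzki_radical (L : set R) : Prop :=
  [/\ two_sided_ideal L, locally_nilpotent L
    & forall I : set R, two_sided_ideal I -> locally_nilpotent I -> I `<=` L].

(* The largest locally nilpotent ideal is unique when it exists, so this says
   that Nil R is equal to it. *)
Definition weakly_2primal : Prop := is_Levitzki_radical Nil.

End RingNotions.

(* The library's algType k assumes 1 <> 0, whereas the zero algebra has to be
   allowed here: it can be an argument of the tensor product, or its value even
   on nonzero algebras (Z/2 and Z/3 over Z). *)
HB.mixin Record PzRing_isPzAlgebra (k : comPzRingType) A of GRing.PzRing A := {
  ascale : k -> A -> A;
  ascaleA : forall c d x, ascale c (ascale d x) = ascale (c * d) x;
  ascale1 : forall x, ascale 1 x = x;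
  ascaleDr : forall c x y, ascale c (x + y) = ascale c x + ascale c y;
  ascaleDl : forall c d x, ascale (c + d) x = ascale c x + ascale d x;
  ascaleAl : forall c (x y : A), ascale c (x * y) = ascale c x * y;
  ascaleAr : forall c (x y : A), ascale c (x * y) = x * ascale c y }.

#[short(type="pzAlgType")]
HB.structure Definition PzAlgebra (k : comPzRingType) :=
  { A of GRing.PzRing A & PzRing_isPzAlgebra k A }.

Lemma ascale0 (k : comPzRingType) (A : pzAlgType k) (x : A) :
  ascale (0 : k) x = 0.
Proof. by apply: (addIr (ascale (0 : k) x)); rewrite -ascaleDl !add0r. Qed.

Lemma ascaler0 (k : comPzRingType) (A : pzAlgType k) (c : k) :
  ascale c (0 : A) = 0.
Proof. by apply: (addIr (ascale c (0 : A))); rewrite -ascaleDr !add0r. Qed.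

(* The tensor product is the quotient of the free commutative monoid on A * B
   (a list stands for the formal sum of its entries) by the congruence
   generated by bilinearity.  The quotient is a group, as (- a, b) is opposite
   to (a, b). *)
Section Tensor.
Variables (k : comPzRingType) (A B : pzAlgType k).

Inductive tens_rel : seq (A * B) -> seq (A * B) -> Prop :=
| tens_refl s : tens_rel s s
| tens_sym s t : tens_rel s t -> tens_rel t s
| tens_trans s t u : tens_rel s t -> tens_rel t u -> tens_rel s u
| tens_cat s s' t t' :
    tens_rel s s' -> tens_rel t t' -> tens_rel (s ++ t) (s' ++ t')
| tens_catC s t : tens_rel (s ++ t) (t ++ s)
| tens_Dl a a' b : tens_rel [:: (a + a', b)] [:: (a, b); (a', b)]
| tens_Dr a b b' : tens_rel [:: (a, b + b')] [:: (a, b); (a, b')]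
| tens_0l b : tens_rel [:: (0, b)] [::]
| tens_Z (c : k) a b :
    tens_rel [:: (ascale c a, b)] [:: (a, ascale c b)].
Local Hint Resolve tens_refl : core.

Definition tens_eq (s t : seq (A * B)) : bool := `[< tens_rel s t >].

Lemma tens_eq_equiv : equiv_class_of tens_eq.
Proof.
split=> [s|s t|t s u].
- by apply/asboolP.
- by apply/asboolP/asboolP; exact: tens_sym.
- by move=> /asboolP st /asboolP tu; apply/asboolP; exact: tens_trans tu.
Qed.
Canonical tens_equiv := EquivRelPack tens_eq_equiv.

Definition tensor : Type := {eq_quot tens_equiv}.
HB.instance Definition _ := Choice.on tensor.

Definition tens_pi (s : seq (A * B)) : tensor := \pi_({eq_quot tens_equiv}) s.
Definition tens_repr (x : tensor) : seq (A * B) :=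
  repr (x : {eq_quot tens_equiv}).

Definition tens (a : A) (b : B) : tensor := tens_pi [:: (a, b)].

Lemma tens_piP s t : tens_pi s = tens_pi t <-> tens_rel s t.
Proof.
split=> [/eqP|st]; first by rewrite eqmodE => /asboolP.
by apply/eqP; rewrite eqmodE; apply/asboolP.
Qed.

Lemma tens_reprK x : tens_pi (tens_repr x) = x.
Proof. exact: reprK. Qed.

Lemma tens_repr_pi s : tens_rel (tens_repr (tens_pi s)) s.
Proof. by apply/tens_piP; rewrite tens_reprK. Qed.

Lemma tens_pi_ind (P : tensor -> Prop) :
  (forall s, P (tens_pi s)) -> forall x, P x.
Proof. by move=> Ps x; rewrite -(tens_reprK x). Qed.

Lemma tens_cat4 s t u v :
  tens_rel ((s ++ t) ++ (u ++ v)) ((s ++ u) ++ (t ++ v)).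
Proof.
rewrite -!catA; apply: tens_cat => //; rewrite !catA.
by apply: tens_cat => //; exact: tens_catC.
Qed.

Definition tens_map (f : A -> A) (g : B -> B) (s : seq (A * B)) :=
  [seq (f p.1, g p.2) | p <- s].

Definition fmul (s t : seq (A * B)) : seq (A * B) :=
  [seq (p.1 * q.1, p.2 * q.2) | p <- s, q <- t].

Lemma tens_map_cat f g s t :
  tens_map f g (s ++ t) = tens_map f g s ++ tens_map f g t.
Proof. exact: map_cat. Qed.

Lemma tens_map_rel f g s t : f 0 = 0 -> {morph f : x y / x + y} ->
    {morph g : x y / x + y} ->
    (forall (c : k) x, f (ascale c x) = ascale c (f x)) ->
    (forall (c : k) x, g (ascale c x) = ascale c (g x)) ->
  tens_rel s t -> tens_rel (tens_map f g s) (tens_map f g t).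
Proof.
move=> f0 fD gD fZ gZ; elim=> {s t} /=.
- by [].
- by move=> s t _; exact: tens_sym.
- by move=> s t u _ st _; exact: tens_trans.
- by move=> s s' t t' _ ss' _ tt'; rewrite !tens_map_cat; exact: tens_cat.
- by move=> s t; rewrite !tens_map_cat; exact: tens_catC.
- by move=> a a' b; rewrite fD; exact: tens_Dl.
- by move=> a b b'; rewrite gD; exact: tens_Dr.
- by move=> b; rewrite f0; exact: tens_0l.
- by move=> c a b; rewrite fZ gZ; exact: tens_Z.
Qed.

Lemma fmul_cons p s t :
  fmul (p :: s) t = tens_map ( *%R p.1) ( *%R p.2) t ++ fmul s t.
Proof. by []. Qed.

Lemma fmul_catl s s' t : fmul (s ++ s') t = fmul s t ++ fmul s' t.
Proof. by rewrite /fmul map_cat flatten_cat. Qed.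

Lemma fmul_relr s t t' : tens_rel t t' -> tens_rel (fmul s t) (fmul s t').
Proof.
move=> tt'; elim: s => [//|p s IHs]; rewrite !fmul_cons.
apply: tens_cat => //; apply: tens_map_rel => //.
- exact: mulr0.
- exact: mulrDr.
- exact: mulrDr.
- by move=> c x; rewrite ascaleAr.
- by move=> c x; rewrite ascaleAr.
Qed.

Lemma fmul_seq1 p t : fmul [:: p] t = tens_map ( *%R p.1) ( *%R p.2) t.
Proof. by rewrite fmul_cons cats0. Qed.

Lemma fmul_rell s s' t : tens_rel s s' -> tens_rel (fmul s t) (fmul s' t).
Proof.
elim=> {s s'}.
- by [].
- by move=> s u _; exact: tens_sym.
- by move=> s u v _ su _; exact: tens_trans.
- by move=> s s' u u' _ ss' _ uu'; rewrite !fmul_catl; exact: tens_cat.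
- by move=> s u; rewrite !fmul_catl; exact: tens_catC.
- move=> a a' b; rewrite -cat1s fmul_catl !fmul_seq1 /=.
  elim: t => [//|[x y] t IHt] /=; rewrite mulrDl.
  apply: (tens_trans (tens_cat (tens_Dl _ _ _) IHt)).
  exact: (tens_cat4 [:: (a * x, b * y)] [:: (a' * x, b * y)]).
- move=> a b b'; rewrite -[X in tens_rel _ (fmul X _)]cat1s fmul_catl !fmul_seq1.
  elim: t => [//|[x y] t IHt] /=; rewrite mulrDl.
  apply: (tens_trans (tens_cat (tens_Dr _ _ _) IHt)).
  exact: (tens_cat4 [:: (a * x, b * y)] [:: (a * x, b' * y)]).
- move=> b; rewrite fmul_seq1.
  elim: t => [//|[x y] t IHt] /=; rewrite mul0r.
  exact: (tens_cat (tens_0l _) IHt).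
- move=> c a b; rewrite !fmul_seq1.
  elim: t => [//|[x y] t IHt] /=; rewrite -!ascaleAl.
  exact: (tens_cat (tens_Z _ _ _) IHt).
Qed.

Definition tens_add (x y : tensor) := tens_pi (tens_repr x ++ tens_repr y).
Definition tens_opp (x : tensor) := tens_pi (tens_map -%R id (tens_repr x)).
Definition tens_mul (x y : tensor) := tens_pi (fmul (tens_repr x) (tens_repr y)).
Definition tens_scale (c : k) (x : tensor) :=
  tens_pi (tens_map (ascale c) id (tens_repr x)).

Lemma tens_addE s t : tens_add (tens_pi s) (tens_pi t) = tens_pi (s ++ t).
Proof. by apply/tens_piP; apply: tens_cat; exact: tens_repr_pi. Qed.

Lemma tens_oppE s : tens_opp (tens_pi s) = tens_pi (tens_map -%R id s).
Proof.
apply/tens_piP; apply: tens_map_rel (tens_repr_pi s) => //.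
- exact: oppr0.
- exact: opprD.
- move=> c x; apply/eqP; rewrite eq_sym -addr_eq0 -ascaleDr addNr.
  by rewrite ascaler0.
Qed.

Lemma tens_mulE s t : tens_mul (tens_pi s) (tens_pi t) = tens_pi (fmul s t).
Proof.
apply/tens_piP; apply: (tens_trans (fmul_rell _ (tens_repr_pi s))).
exact: fmul_relr (tens_repr_pi t).
Qed.

Lemma tens_scaleE c s :
  tens_scale c (tens_pi s) = tens_pi (tens_map (ascale c) id s).
Proof.
apply/tens_piP; apply: tens_map_rel (tens_repr_pi s) => //.
- exact: ascaler0.
- exact: ascaleDr.
- by move=> d x; rewrite !ascaleA mulrC.
Qed.

Fact tens_addA : associative tens_add.
Proof.
elim/tens_pi_ind=> s; elim/tens_pi_ind=> t; elim/tens_pi_ind=> u.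
by rewrite !tens_addE catA.
Qed.

Fact tens_addC : commutative tens_add.
Proof.
elim/tens_pi_ind=> s; elim/tens_pi_ind=> t; rewrite !tens_addE.
by apply/tens_piP; exact: tens_catC.
Qed.

Fact tens_add0 : left_id (tens_pi [::]) tens_add.
Proof. by elim/tens_pi_ind=> s; rewrite tens_addE. Qed.

Fact tens_addN : left_inverse (tens_pi [::]) tens_opp tens_add.
Proof.
elim/tens_pi_ind=> s; rewrite tens_oppE tens_addE; apply/tens_piP.
elim: s => [//|[a b] s IHs] /=.
apply: (tens_trans (tens_cat4 [:: (- a, b)] _ [:: (a, b)] s)).
apply: (@tens_cat _ [::] _ [::]) => //=.
apply: (tens_trans (tens_sym (tens_Dl (- a) a b))).
by rewrite addNr; exact: tens_0l.
Qed.

HB.instance Definition _ :=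
  GRing.isZmodule.Build tensor tens_addA tens_addC tens_add0 tens_addN.

Lemma tens_piD s t : tens_pi (s ++ t) = tens_pi s + tens_pi t.
Proof. by rewrite -tens_addE. Qed.

Fact tens_mulA : associative tens_mul.
Proof.
elim/tens_pi_ind=> s; elim/tens_pi_ind=> t; elim/tens_pi_ind=> u.
rewrite !tens_mulE; congr tens_pi.
elim: s => [//|p s IHs]; rewrite !fmul_cons fmul_catl -IHs; congr (_ ++ _).
elim: t {IHs} => [//|q t IHt]; rewrite [tens_map _ _ (q :: t)]/=.
rewrite !fmul_cons tens_map_cat IHt; congr (_ ++ _).
by rewrite /tens_map -map_comp; apply: eq_map => r /=; rewrite !mulrA.
Qed.

Fact tens_mul1x : left_id (tens 1 1) tens_mul.
Proof.
elim/tens_pi_ind=> s; rewrite tens_mulE fmul_seq1; congr tens_pi.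
by rewrite /tens_map -[RHS]map_id; apply: eq_map => -[a b] /=; rewrite !mul1r.
Qed.

Fact tens_mulx1 : right_id (tens 1 1) tens_mul.
Proof.
elim/tens_pi_ind=> s; rewrite tens_mulE; congr tens_pi.
by elim: s => [//|[a b] s IHs]; rewrite fmul_cons IHs /= !mulr1.
Qed.

Fact tens_mulDl : left_distributive tens_mul +%R.
Proof.
elim/tens_pi_ind=> s; elim/tens_pi_ind=> t; elim/tens_pi_ind=> u.
by rewrite -tens_piD !tens_mulE -tens_piD fmul_catl.
Qed.

Fact tens_mulDr : right_distributive tens_mul +%R.
Proof.
elim/tens_pi_ind=> s; elim/tens_pi_ind=> t; elim/tens_pi_ind=> u.
rewrite -tens_piD !tens_mulE -tens_piD; apply/tens_piP.
elim: s => [//|p s IHs]; rewrite !fmul_cons tens_map_cat.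
apply: tens_trans (tens_cat4 _ _ _ _).
exact: tens_cat.
Qed.

HB.instance Definition _ := GRing.Zmodule_isPzRing.Build tensor
  tens_mulA tens_mul1x tens_mulx1 tens_mulDl tens_mulDr.

Fact tens_scaleA c d x :
  tens_scale c (tens_scale d x) = tens_scale (c * d) x.
Proof.
elim/tens_pi_ind: x => s; rewrite !tens_scaleE; congr tens_pi.
by rewrite /tens_map -map_comp; apply: eq_map => p /=; rewrite ascaleA.
Qed.

Fact tens_scale1 x : tens_scale 1 x = x.
Proof.
elim/tens_pi_ind: x => s; rewrite tens_scaleE; congr tens_pi.
by rewrite /tens_map -[RHS]map_id; apply: eq_map => -[a b] /=; rewrite ascale1.
Qed.

Fact tens_scaleDr c x y :
  tens_scale c (x + y) = tens_scale c x + tens_scale c y.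
Proof.
elim/tens_pi_ind: x => s; elim/tens_pi_ind: y => t.
by rewrite -tens_piD !tens_scaleE tens_map_cat tens_piD.
Qed.

Fact tens_scaleDl c d x :
  tens_scale (c + d) x = tens_scale c x + tens_scale d x.
Proof.
elim/tens_pi_ind: x => s; rewrite !tens_scaleE -tens_piD; apply/tens_piP.
elim: s => [//|[a b] s IHs] /=; rewrite ascaleDl.
apply: (tens_trans (tens_cat (tens_Dl _ _ _) IHs)).
exact: (tens_cat4 [:: (ascale c a, b)] [:: (ascale d a, b)]).
Qed.

Fact tens_scaleAl c (x y : tensor) :
  tens_scale c (x * y) = tens_scale c x * y.
Proof.
elim/tens_pi_ind: x => s; elim/tens_pi_ind: y => t.
rewrite /GRing.mul /= tens_scaleE !tens_mulE tens_scaleE; congr tens_pi.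
elim: s => [//|p s IHs]; rewrite !fmul_cons tens_map_cat IHs; congr (_ ++ _).
by rewrite /tens_map -map_comp; apply: eq_map => q /=; rewrite ascaleAl.
Qed.

Fact tens_scaleAr c (x y : tensor) :
  tens_scale c (x * y) = x * tens_scale c y.
Proof.
elim/tens_pi_ind: x => s; elim/tens_pi_ind: y => t.
rewrite /GRing.mul /= tens_scaleE !tens_mulE tens_scaleE; congr tens_pi.
elim: s => [//|p s IHs]; rewrite !fmul_cons tens_map_cat IHs; congr (_ ++ _).
by rewrite /tens_map -!map_comp; apply: eq_map => q /=; rewrite ascaleAr.
Qed.

HB.instance Definition _ := PzRing_isPzAlgebra.Build k tensor
  tens_scaleA tens_scale1 tens_scaleDr tens_scaleDl tens_scaleAl tens_scaleAr.

Lemma tensM a a' b b' : tens a b * tens a' b' = tens (a * a') (b * b').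
Proof. exact: tens_mulE. Qed.

Lemma tens1 : 1 = tens 1 1.
Proof. by []. Qed.

Lemma tensZl (c : k) a b : tens (ascale c a) b = ascale c (tens a b).
Proof. by rewrite [RHS]tens_scaleE. Qed.

Lemma tensZr (c : k) a b : tens a (ascale c b) = ascale c (tens a b).
Proof. by rewrite -tensZl; apply/tens_piP/tens_sym; exact: tens_Z. Qed.

Lemma tensDl a a' b : tens (a + a') b = tens a b + tens a' b.
Proof. by rewrite -tens_piD; apply/tens_piP; exact: tens_Dl. Qed.

Lemma tensDr a b b' : tens a (b + b') = tens a b + tens a b'.
Proof. by rewrite -tens_piD; apply/tens_piP; exact: tens_Dr. Qed.

Lemma tens_sum s : tens_pi s = \sum_(p <- s) tens p.1 p.2.
Proof.
elim: s => [|[a b] s IHs]; first by rewrite big_nil.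
by rewrite big_cons -IHs -tens_piD.
Qed.

Lemma tensor_universal (M : lmodType k) (f : A -> B -> M) :
    (forall a a' b, f (a + a') b = f a b + f a' b) ->
    (forall a b b', f a (b + b') = f a b + f a b') ->
    (forall (c : k) a b, f (ascale c a) b = c *: f a b) ->
    (forall (c : k) a b, f a (ascale c b) = c *: f a b) ->
  exists! g : tensor -> M,
    [/\ {morph g : x y / x + y}, (forall c x, g (ascale c x) = c *: g x)
      & forall a b, g (tens a b) = f a b].
Proof.
move=> fDl fDr fZl fZr; pose h s := \sum_(p <- s) f p.1 p.2.
have hrel s t : tens_rel s t -> h s = h t.
  elim=> {s t}; rewrite /h.
  - by [].
  - by [].
  - by move=> s t u _ -> _ ->.
  - by move=> s s' t t' _ IHs _ IHt; rewrite !big_cat /= IHs IHt.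
  - by move=> s t; rewrite !big_cat /= addrC.
  - by move=> a a' b; rewrite !big_cons !big_nil !addr0 /= fDl.
  - by move=> a b b'; rewrite !big_cons !big_nil !addr0 /= fDr.
  - by move=> b; rewrite big_seq1 big_nil -(ascale0 0) fZl scale0r.
  - by move=> c a b; rewrite !big_seq1 /= fZl fZr.
have hE s : h (tens_repr (tens_pi s)) = h s by apply/hrel/tens_repr_pi.
exists (fun x => h (tens_repr x)); split.
  split.
  - elim/tens_pi_ind=> s; elim/tens_pi_ind=> t.
    by rewrite -tens_piD !hE /h big_cat.
  - move=> c; elim/tens_pi_ind=> s.
    rewrite [ascale c _]tens_scaleE !hE /h big_map scaler_sumr.
    by apply: eq_bigr => p _; rewrite fZl.
  - by move=> a b; rewrite hE /h big_seq1.
move=> g [gD _ gt]; apply/funext; elim/tens_pi_ind=> s; rewrite hE.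
have g0 : g 0 = 0 by apply: (addIr (g 0)); rewrite -gD !add0r.
elim: s => [|[a b] s IHs]; first by rewrite /h big_nil -[LHS]g0.
by rewrite -cat1s tens_piD gD gt -IHs /h big_cat big_seq1.
Qed.

End Tensor.

(* Main.v *)
(** A ring A whose nilpotents form an ideal N has A / N reduced, and if A is
    periodic then A / N satisfies x^(d+1) = x, hence is commutative by Jacobson's
    theorem.  Let J = N_A (x) B + A (x) N_B.  It is a nil ideal because N_A and N_B
    are locally nilpotent, and (A (x) B) / J is commutative.  A periodic ring has
    c = 0 for some integer c > 0, and in a commutative ring with that property the
    periodic elements are closed under sum and product, since the monomials
    x^i y^j span a finite ring; so (A (x) B) / J, generated by the a (x) 1 and
    1 (x) b, is periodic.  Finally t^m - t^n nilpotent implies t^(mM) = t^(nM) for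
    a suitable multiple M of c.

    For Jacobson's theorem, if z = xy - yx is nonzero then an ideal maximal among
    those avoiding the idempotent power of z has a quotient that is a periodic
    domain in which z survives.  In such a domain, let a be noncentral; Z[a] is a
    finite field F, and right multiplication by a is diagonalizable over F, so that
    y a = f y for some y <> 0 and some f <> a in F.  The powers of y span over F a
    finite domain, commutative by Wedderburn's theorem, a contradiction. *)

Require Import Defs.
From HB Require Import structures.
From mathcomp Require Import all_boot all_algebra finfield.
From mathcomp Require Import boolp classical_sets.

Set Implicit Arguments.
Unset Strict Implicit.
Unset Printing Implicit Defensive.

Import GRing.Theory.
Local Open Scope ring_scope.
Local Open Scope quotient_scope.
Local Open Scope classical_set_scope.

(** * Quotient by a two-sided ideal *)

Section QuotientRing.
Variables (R : pzRingType) (I : set R) (idI : two_sided_ideal I).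

Lemma idealN x : I x -> I (- x).
Proof. by move: idI => [I0 IB _ _] Ix; rewrite -[- x]sub0r; exact: IB. Qed.

Lemma idealD x y : I x -> I y -> I (x + y).
Proof.
by move: (idI) => [_ IB _ _] Ix Iy; rewrite -[y]opprK; exact/IB/idealN.
Qed.

Definition ideal_eq (x y : R) : bool := `[< I (x - y) >].

Lemma ideal_eq_equiv : equiv_class_of ideal_eq.
Proof.
split=> [x|x y|y x z].
- by apply/asboolP; rewrite subrr; case: idI.
- by apply/asboolP/asboolP=> /idealN; rewrite opprB.
- by move=> /asboolP xy /asboolP yz; apply/asboolP; rewrite -(subrKA y); exact: idealD.
Qed.
Canonical ideal_equiv := EquivRelPack ideal_eq_equiv.

Definition quot : Type := {eq_quot ideal_equiv}.
HB.instance Definition _ := Choice.on quot.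

Definition quot_pi (x : R) : quot := \pi_({eq_quot ideal_equiv}) x.
Definition quot_repr (u : quot) : R := repr (u : {eq_quot ideal_equiv}).

Lemma quot_piP x y : quot_pi x = quot_pi y <-> I (x - y).
Proof.
split=> [/eqP|xy]; first by rewrite eqmodE => /asboolP.
by apply/eqP; rewrite eqmodE; apply/asboolP.
Qed.

Lemma quot_reprK u : quot_pi (quot_repr u) = u.
Proof. exact: reprK. Qed.

Lemma quot_ind (P : quot -> Prop) : (forall x, P (quot_pi x)) -> forall u, P u.
Proof. by move=> Px u; rewrite -(quot_reprK u). Qed.

Lemma quot_repr_pi x : I (quot_repr (quot_pi x) - x).
Proof. by apply/quot_piP; rewrite quot_reprK. Qed.

Definition quot_add u v := quot_pi (quot_repr u + quot_repr v).
Definition quot_opp u := quot_pi (- quot_repr u).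
Definition quot_mul u v := quot_pi (quot_repr u * quot_repr v).

Lemma quot_addE x y : quot_add (quot_pi x) (quot_pi y) = quot_pi (x + y).
Proof.
by apply/quot_piP; rewrite opprD addrACA; apply: idealD; exact: quot_repr_pi.
Qed.

Lemma quot_oppE x : quot_opp (quot_pi x) = quot_pi (- x).
Proof. by apply/quot_piP; rewrite -opprD; exact/idealN/quot_repr_pi. Qed.

Lemma quot_mulE x y : quot_mul (quot_pi x) (quot_pi y) = quot_pi (x * y).
Proof.
apply/quot_piP; rewrite -(subrKA (x * quot_repr (quot_pi y))).
rewrite -mulrBl -mulrBr; case: idI => _ _ Il Ir.
by apply: idealD; [apply: Ir | apply: Il]; exact: quot_repr_pi.
Qed.

Fact quot_addA : associative quot_add.
Proof.
by do 3![elim/quot_ind=> ?]; rewrite !quot_addE addrA.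
Qed.

Fact quot_addC : commutative quot_add.
Proof. by do 2![elim/quot_ind=> ?]; rewrite !quot_addE addrC. Qed.

Fact quot_add0 : left_id (quot_pi 0) quot_add.
Proof. by elim/quot_ind=> x; rewrite quot_addE add0r. Qed.

Fact quot_addN : left_inverse (quot_pi 0) quot_opp quot_add.
Proof. by elim/quot_ind=> x; rewrite quot_oppE quot_addE addNr. Qed.

HB.instance Definition _ :=
  GRing.isZmodule.Build quot quot_addA quot_addC quot_add0 quot_addN.

Lemma quot_piD : {morph quot_pi : x y / x + y}.
Proof. by move=> x y; rewrite -quot_addE. Qed.

Fact quot_mulA : associative quot_mul.
Proof. by do 3![elim/quot_ind=> ?]; rewrite !quot_mulE mulrA. Qed.

Fact quot_mul1x : left_id (quot_pi 1) quot_mul.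
Proof. by elim/quot_ind=> x; rewrite quot_mulE mul1r. Qed.

Fact quot_mulx1 : right_id (quot_pi 1) quot_mul.
Proof. by elim/quot_ind=> x; rewrite quot_mulE mulr1. Qed.

Fact quot_mulDl : left_distributive quot_mul +%R.
Proof.
by do 3![elim/quot_ind=> ?]; rewrite -quot_piD !quot_mulE -quot_piD mulrDl.
Qed.

Fact quot_mulDr : right_distributive quot_mul +%R.
Proof.
by do 3![elim/quot_ind=> ?]; rewrite -quot_piD !quot_mulE -quot_piD mulrDr.
Qed.

HB.instance Definition _ := GRing.Zmodule_isPzRing.Build quot
  quot_mulA quot_mul1x quot_mulx1 quot_mulDl quot_mulDr.

Fact quot_pi_zmod : zmod_morphism quot_pi.
Proof. by move=> x y; rewrite quot_piD -quot_oppE. Qed.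
HB.instance Definition _ := GRing.isZmodMorphism.Build R quot quot_pi quot_pi_zmod.

Fact quot_pi_monoid : monoid_morphism quot_pi.
Proof. by split=> // x y; rewrite -quot_mulE. Qed.
HB.instance Definition _ := GRing.isMonoidMorphism.Build R quot quot_pi quot_pi_monoid.

Lemma quot_pi_eq0 x : quot_pi x = 0 <-> I x.
Proof. by rewrite -{2}[x]subr0; exact: quot_piP. Qed.

End QuotientRing.

(** * Periodic elements and finite spans *)

Section PeriodicElements.
Variable R : pzRingType.

Definition periodic_elt (x : R) : Prop :=
  exists m n : nat, [/\ (0 < m)%N, (0 < n)%N, m <> n & x ^+ m = x ^+ n].

Definition powers (x : R) (n : nat) : seq R := [seq x ^+ i | i <- iota 0 n].

Lemma periodic_ltn (x : R) : periodic_elt x ->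
  exists m n : nat, [/\ (0 < m)%N, (m < n)%N & x ^+ m = x ^+ n].
Proof.
move=> [m [n [m0 n0 mn eqx]]].
by case: (ltngtP m n) mn => // [mn|nm] _; [exists m, n|exists n, m].
Qed.

Lemma ltn_periodic (x : R) m n : (m < n)%N -> x ^+ m = x ^+ n -> periodic_elt x.
Proof.
move=> mn eqx; exists m.+1, n.+1; rewrite !exprS eqx; split=> // -[mnE].
by rewrite mnE ltnn in mn.
Qed.

Lemma periodic_powers (x : R) : periodic_elt x ->
  exists n, forall i, x ^+ i \in powers x n.
Proof.
move=> /periodic_ltn[m [n [_ mn eqx]]]; exists n => i.
elim/ltn_ind: i => i IHi; case: (ltnP i n) => [lt_in|le_ni].
  by apply/mapP; exists i; rewrite // mem_iota.
(* Replacing [x ^+ n] by [x ^+ m] lowers the exponent by n - m > 0. *)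
rewrite -(subnK le_ni) exprD -eqx -exprD; apply: IHi.
by rewrite -[ltnRHS](subnK le_ni) ltn_add2l.
Qed.

(** Pigeonhole: the first [(size s).+1] powers of [x] cannot be pairwise distinct. *)
Lemma powers_periodic (x : R) (s : seq R) :
  (forall i, x ^+ i \in s) -> periodic_elt x.
Proof.
move=> xs; pose l := powers x (size s).+1.
have : ~~ uniq l.
  apply: contraT; rewrite negbK => /uniq_leq_size-/(_ s).
  rewrite size_map size_iota ltnn => -> //= _ /mapP[i _ ->]; exact: xs.
case/(uniqPn 0) => i [j [ij]]; rewrite size_map size_iota => jn.
have iN := ltn_trans ij jn.
by rewrite !(nth_map 0) ?size_iota // !nth_iota // => /(ltn_periodic ij).
Qed.

(* Negative coefficients are not needed: rings here have positive characteristic. *)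
Definition sum_of (E : seq R) (x : R) : Prop :=
  exists2 l : seq R, {subset l <= E} & x = \sum_(y <- l) y.

Lemma sum_of_mem E x : x \in E -> sum_of E x.
Proof. by move=> Ex; exists [:: x]; rewrite ?big_seq1 // => y /[!inE]/eqP->. Qed.

Lemma sum_ofD E x y : sum_of E x -> sum_of E y -> sum_of E (x + y).
Proof.
move=> [l lE ->] [l' lE' ->]; exists (l ++ l'); rewrite ?big_cat // => z.
by rewrite mem_cat => /orP[/lE|/lE'].
Qed.

Lemma sum_ofMn E x n : sum_of E x -> sum_of E (x *+ n).
Proof.
move=> Ex; elim: n => [|n IHn]; first by exists [::]; rewrite ?big_nil.
by rewrite mulrS; exact: sum_ofD.
Qed.

Lemma sum_ofM E x y : {in E &, forall e e', e * e' \in E} ->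
  sum_of E x -> sum_of E y -> sum_of E (x * y).
Proof.
move=> EM [l lE ->] [l' lE' ->]; exists [seq e * e' | e <- l, e' <- l'].
  by move=> _ /allpairsP[[e e'] /= [/lE ? /lE' ? ->]]; exact: EM.
by rewrite big_allpairs_dep mulr_suml; apply: eq_bigr => e _; rewrite mulr_sumr.
Qed.

(** Only the multiplicity of each element of [E] modulo [c] matters, so finitely many families of
    coefficients give every sum. *)
Lemma sum_of_finite (E : seq R) (c : nat) : (0 < c)%N -> c%:R = 0 :> R ->
  exists s : seq R, forall x, x \in s <-> sum_of E x.
Proof.
case: c => // c _ c0.
pose g (f : {ffun seq_sub E -> 'I_c.+1}) : R := \sum_e val e *+ f e.
exists (codom g) => x; split=> [/codomP[f ->]|[l lE ->]].
  rewrite /g; elim/big_rec: _ => [|e y _ Ey]; first by exists [::]; rewrite ?big_nil.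
  by apply: sum_ofD => //; apply/sum_ofMn/sum_of_mem/valP.
have [f ->] : exists f : seq_sub E -> nat, \sum_(y <- l) y = \sum_e val e *+ f e.
  elim: l lE => [|y l IHl] lE.
    by exists (fun=> 0)%N; rewrite big_nil big1.
  have [|f IHf] := IHl; first by move=> z lz; apply: lE; rewrite in_cons lz orbT.
  have Ey : y \in E by exact/lE/mem_head.
  exists (fun e => (e == SeqSub Ey) + f e)%N; rewrite big_cons IHf.
  under [RHS]eq_bigr do rewrite mulrnDr.
  rewrite big_split; congr (_ + _).
  rewrite (bigD1 (SeqSub Ey)) // eqxx mulr1n big1 /= ?addr0 //.
  by move=> e /negPf->.
apply/codomP; exists [ffun e => inord (f e %% c.+1)]; rewrite /g.
apply: eq_bigr => e _; rewrite ffunE inordK ?ltn_pmod //.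
rewrite {1}(divn_eq (f e) c.+1) mulrnDr mulnC mulrnA.
by rewrite -(mulr_natr _ c.+1) c0 mulr0 mul0rn add0r.
Qed.

Lemma sum_of_periodic (E : seq R) (c : nat) (x : R) :
    (0 < c)%N -> c%:R = 0 :> R ->
    1 \in E -> {in E &, forall e e', e * e' \in E} ->
  sum_of E x -> periodic_elt x.
Proof.
move=> c_gt0 c0 E1 EM Ex; have [s sE] := sum_of_finite E c_gt0 c0.
apply: (@powers_periodic _ s) => i; apply/sE.
elim: i => [|i IHi]; first exact: sum_of_mem.
by rewrite exprS; exact: sum_ofM.
Qed.

Lemma periodicDM (c : nat) (x y : R) : (0 < c)%N -> c%:R = 0 :> R ->
    x * y = y * x -> periodic_elt x -> periodic_elt y ->
  periodic_elt (x + y) /\ periodic_elt (x * y).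
Proof.
move=> c_gt0 c0 xy /periodic_powers[m xm] /periodic_powers[n yn].
pose E := [seq e * e' | e <- powers x m, e' <- powers y n].
(* All exponents are allowed, because the two finite lists already contain every power of [x] and of
   [y]. *)
have monE i j : x ^+ i * y ^+ j \in E by apply: allpairs_f.
have E1 : 1 \in E by rewrite -[1]mulr1; exact: (monE 0 0)%N.
have EM : {in E &, forall e e', e * e' \in E}.
  move=> _ _ /allpairsP[[_ _] /= [/mapP[i _ ->] /mapP[j _ ->] ->]]
    /allpairsP[[_ _] /= [/mapP[i' _ ->] /mapP[j' _ ->] ->]].
  rewrite mulrA -[_ * _ * x ^+ i']mulrA (commrX i' (commr_sym (commrX j xy))).
  by rewrite mulrA -exprD -mulrA -exprD.
have Ex : x \in E by rewrite -[x]mulr1; exact: (monE 1 0)%N.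
have Ey : y \in E by rewrite -[y]mul1r; exact: (monE 0 1)%N.
by split; apply: (sum_of_periodic c_gt0 c0 E1 EM);
  [apply: sum_ofD|apply: sum_ofM EM _ _]; exact: sum_of_mem.
Qed.

End PeriodicElements.

(** * Jacobson's theorem for periodic reduced rings *)

Section FiniteSubring.
Variables (D : nzRingType) (s : seq D) (sP : subring_closed (mem s)).

Definition finite_subring : Type := seq_sub s.
HB.instance Definition _ := SubFinite.on finite_subring.
HB.instance Definition _ :=
  GRing.SubChoice_isSubNzRing.Build D (mem s) finite_subring sP.
HB.instance Definition _ := FinRing.isNzRing.Build finite_subring.

(** A finite domain is a field by Wedderburn's theorem, which is contained in
    [FinDomainFieldType]. *)
Lemma finite_subring_field :
    GRing.integral_domain_axiom D ->
  exists (F : finFieldType) (iota : {rmorphism F -> D}),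
    forall x, x \in s <-> exists c, iota c = x.
Proof.
move=> domD; have domT : GRing.integral_domain_axiom finite_subring.
  move=> x y xy0; rewrite -!(inj_eq val_inj) !rmorph0; apply: domD.
  by rewrite -rmorphM xy0 rmorph0.
pose F := FinDomainFieldType domT; pose f : F -> D := val.
have fB : zmod_morphism f by exact: rmorphB.
have fM : monoid_morphism f by split=> [|x y]; [exact: rmorph1|exact: rmorphM].
pose iota : {rmorphism F -> D} := HB.pack f
  (GRing.isZmodMorphism.Build F D f fB) (GRing.isMonoidMorphism.Build F D f fM).
exists F, iota => x; split=> [sx|[c <-]]; first by exists (SeqSub sx).
exact: (valP (c : finite_subring)).
Qed.

End FiniteSubring.
(** Periodicity of the element 2 makes some 2^n - 2^m with m < n vanish in [R]. *)
Lemma periodic_char (R : pzRingType) : periodic R ->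
  exists2 c : nat, (0 < c)%N & c%:R = 0 :> R.
Proof.
move=> /(_ 2%:R)/periodic_ltn[m [n [_ mn eq2]]].
exists (2 ^ n - 2 ^ m)%N; first by rewrite subn_gt0 ltn_exp2l.
by rewrite natrB ?leq_exp2l ?(ltnW mn) // !natrX eq2 subrr.
Qed.

(** * Commutativity of periodic domains *)

Section PeriodicDomain.
Variable D : nzRingType.
Hypotheses (domD : GRing.integral_domain_axiom D) (perD : periodic D).

Lemma sum_of_field (E : seq D) : 1 \in E -> {in E &, forall e e', e * e' \in E} ->
  exists (F : finFieldType) (iota : {rmorphism F -> D}),
    forall x, sum_of E x <-> exists c, iota c = x.
Proof.
move=> E1 EM; have [[|c] // c_gt0 c0] := periodic_char perD.
have [s sE] := sum_of_finite E c_gt0 c0.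
suff sP : subring_closed (mem s).
  have [F [iota iotaP]] := finite_subring_field sP domD.
  by exists F, iota => x; rewrite -sE.
split=> [|x y /sE Ex /sE Ey|x y /sE Ex /sE Ey]; apply/sE.
- exact: sum_of_mem.
- have -> : - y = y *+ c.
    by apply/eqP; rewrite eq_sym -addr_eq0 -mulrSr -mulr_natr c0 mulr0.
  by apply: sum_ofD => //; exact: sum_ofMn.
- exact: sum_ofM.
Qed.

(* The polynomial ring over F acts on D, with 'X acting as right multiplication
   by a; every element is killed by 'X^#|F| - 'X = \prod_f ('X - f), so that this
   operator is diagonalizable, with eigenvalues in F. *)
Lemma right_mul_eigenvector (F : finFieldType) (iota : {rmorphism F -> D})
    (a : F) (x : D) : x * iota a != iota a * x ->
  exists f y, [/\ f != a, y != 0 & y * iota a = iota f * y].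
Proof.
move=> xa; pose act P := (map_poly iota P * x%:P).[iota a].
have actXsub f P : act (('X - f%:P) * P) = act P * iota a - iota f * act P.
  rewrite /act rmorphM rmorphB /= map_polyX map_polyC /= -mulrA mulrBl hornerD.
  by rewrite hornerN hornerCM -commr_polyX hornerMX.
have genP : act (\prod_(f <- [seq f <- index_enum F | f != a]) ('X - f%:P)
                 * ('X - a%:P)) = 0.
  have := finField_genPoly F; rewrite (bigD1 a) //= big_filter mulrC => <-.
  rewrite /act rmorphB /=.
  rewrite map_polyXn map_polyX mulrBl -commr_polyX -commr_polyXn hornerD hornerN.
  by rewrite !hornerCM hornerXn hornerX -rmorphXn /= expf_card subrr.
(* The factors 'X - f are stripped off one by one. The first nonzero value met is killed by the
   factor just removed, hence is an eigenvector. One is met because 'X - a sends [x] to x a - a x,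
   which is nonzero. *)
elim: [seq f <- _ | _] (filter_all (fun f => f != a) (index_enum F)) genP => [|f s IHs] /=.
  move=> _; rewrite big_nil mul1r -[_ - _]mulr1 actXsub /act rmorph1 mul1r hornerC.
  by move=> /eqP; rewrite subr_eq0 (negPf xa).
case/andP=> fa sa; rewrite big_cons -mulrA actXsub => /eqP; rewrite subr_eq0 => /eqP.
set y := act _ => yP; have [y0|y0] := eqVneq y 0; first exact: IHs.
by exists f, y.
Qed.

Lemma periodic_domain_mulC (x a : D) : x * a = a * x.
Proof.
apply/eqP; apply: contraT => xa.
have [n an] := periodic_powers (perD a).
have [|? ? /mapP[i _ ->] /mapP[j _ ->]|F [iota iotaP]] := @sum_of_field (powers a n).
- exact: (an 0)%N.
- by rewrite -exprD.
have [a0 a0E] : exists c, iota c = a by apply/iotaP/sum_of_mem; exact: (an 1)%N.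
rewrite -a0E in xa; have [f [y [fa y0 yf]]] := right_mul_eigenvector xa.
have yX i : y * iota a0 ^+ i = iota (f ^+ i) * y.
  elim: i => [|i IHi]; first by rewrite rmorph1 mulr1 mul1r.
  by rewrite !exprSr mulrA IHi rmorphM -!mulrA yf.
(* As [F] is spanned by powers of a, this gives y F inside F y; iterated in [yXF], it makes [E]
   closed under products. *)
have yF c : exists d, y * iota c = iota d * y.
  have [l la ->] : sum_of (powers a n) (iota c) by apply/iotaP; exists c.
  elim: l la => [|e l IHl] la; first by exists 0; rewrite big_nil rmorph0 mulr0 mul0r.
  have [|d dE] := IHl; first by move=> z lz; apply: la; rewrite in_cons lz orbT.
  have /mapP[i _ ->] := la e (mem_head _ _); exists (f ^+ i + d).
  by rewrite big_cons mulrDr dE rmorphD mulrDl -a0E yX.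
have [n' yn] := periodic_powers (perD y).
pose E := [seq iota c * e | c <- enum F, e <- powers y n'].
have inE c i : iota c * y ^+ i \in E by apply: allpairs_f; rewrite ?mem_enum.
have yXF i c : exists d, y ^+ i * iota c = iota d * y ^+ i.
  elim: i => [|i [d IHi]]; first by exists c; rewrite mul1r mulr1.
  by have [d' d'E] := yF d; exists d'; rewrite exprS -mulrA IHi mulrA d'E mulrA.
have [||K [kappa kappaP]] := @sum_of_field E.
- by rewrite -[1]mulr1 -[X in X * _](rmorph1 iota); exact: (inE _ 0)%N.
- move=> _ _ /allpairsP[[c _] /= [_ /mapP[i _ ->] ->]]
    /allpairsP[[d _] /= [_ /mapP[j _ ->] ->]].
  have [d' d'E] := yXF i d.
  rewrite mulrA -[iota c * _ * _]mulrA d'E mulrA -mulrA -rmorphM -exprD.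
  exact: inE.
have /kappaP[u uE] : sum_of E (iota a0).
  by apply: sum_of_mem; rewrite -[iota a0]mulr1; exact: (inE _ 0)%N.
have /kappaP[v vE] : sum_of E y.
  by apply: sum_of_mem; rewrite -[y]mul1r -(rmorph1 iota); exact: (inE _ 1)%N.
(* Both [y] and [iota a0] lie in the image of the field [K], so they commute, and [yf] becomes (f -
   a0) y = 0 with both factors nonzero. *)
move: yf; rewrite -uE -vE -rmorphM mulrC rmorphM uE vE => /eqP.
rewrite eq_sym -subr_eq0 -mulrBl -rmorphB => /eqP/domD.
by rewrite fmorph_eq0 subr_eq0 (negPf fa) (negPf y0).
Qed.
End PeriodicDomain.

(** * Reduction of reduced periodic rings to periodic domains *)

Section ReducedPeriodic.
Variable R : pzRingType.
Hypotheses (perR : periodic R) (redR : forall (x : R) n, x ^+ n = 0 -> x = 0).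

(** If x^m = x^n with n = m + d + 1, then (x^(d+2) - x)^m has the factor (x^(d+1) - 1) x^m = 0, so
    x^(d+2) - x is nilpotent. *)
Lemma reduced_periodic_expr (x : R) : exists d, x ^+ d.+2 = x.
Proof.
have [m [n [m0 mn eqx]]] := periodic_ltn (perR x).
case: m m0 mn eqx => // m _ mn eqx.
have [d nE] : exists d, n = (d.+1 + m.+1)%N.
  by exists (n - m.+2)%N; rewrite addSnnS subnK.
exists d; apply/eqP; rewrite -subr_eq0; apply/eqP/(@redR _ m.+1).
have -> : x ^+ d.+2 - x = (x ^+ d.+1 - 1) * x by rewrite mulrBl mul1r -exprSr.
rewrite exprMn_comm; last by apply/commr_sym/commrB; [exact: commrX|exact: commr1].
by rewrite exprSr -mulrA mulrBl mul1r -exprD -nE eqx subrr mulr0.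
Qed.

(** Both e x - e x e and x e - e x e have square zero. *)
Lemma reduced_idempotent_central (e x : R) : e * e = e -> e * x = x * e.
Proof.
move=> ee; have eeA u : u * e * e = u * e by rewrite -mulrA ee.
transitivity (e * x * e); apply/eqP; last rewrite eq_sym.
all: rewrite -subr_eq0; apply/eqP/(@redR _ 2).
  by rewrite expr2 mulrBl !mulrBr !mulrA !eeA subrr.
by rewrite expr2 mulrBl !mulrBr !mulrA !eeA !subrr.
Qed.

Lemma reduced_periodic_mulC (x y : R) : x * y = y * x.
Proof.
apply/eqP; rewrite -subr_eq0; set z := _ - _; apply: contraT => /eqP z0.
have [d zE] := reduced_periodic_expr z; pose e := z ^+ d.+1.
have ze : z * e = z by rewrite -exprS.
have ee : e * e = e by rewrite {1}/e exprSr -mulrA ze -exprSr.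
(* 0 is not required to be in X, so that the union of the empty chain satisfies P. *)
pose P (X : set R) := [/\ forall u v, X u -> X v -> X (u - v),
  forall a u, X u -> X (a * u), forall a u, X u -> X (u * a) & ~ X e].
have [|M [[MB Ml Mr Me] Mmax]] := @Zorn_bigcup R P.
  move=> F FP Ftot; split.
  - move=> u v [X FX Xu] [Y FY Yv]; case: (Ftot X Y FX FY) => [XY|YX].
      by exists Y => //; case: (FP Y FY) => YB _ _ _; apply: YB => //; exact: XY.
    by exists X => //; case: (FP X FX) => XB _ _ _; apply: XB => //; exact: YX.
  - by move=> a u [X FX Xu]; exists X => //; case: (FP X FX) => _ Xl _ _; exact: Xl.
  - by move=> a u [X FX Xu]; exists X => //; case: (FP X FX) => _ _ Xr _; exact: Xr.
  - by move=> [X FX Xe]; case: (FP X FX).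
have Pmax X : P X -> (forall u, M u -> X u) -> forall u, X u -> M u.
  move=> PX MX u Xu; apply: contrapT => nMu.
  by apply: (Mmax X) => //; split=> [//|/(_ u Xu)].
(* If [M] were empty, the zero ideal would satisfy [P] and contain it, so maximality applies. *)
have M0 : M 0.
  have [[u Mu]|M_0] := pselect (exists u, M u); first by rewrite -(subrr u); exact: MB.
  apply: (Pmax [set 0]) => //; last by move=> u Mu; case: M_0; exists u.
  split=> [u v -> ->|a u ->|a u ->|e0].
  - by rewrite subr0.
  - by rewrite mulr0.
  - by rewrite mul0r.
  - by apply: z0; rewrite -ze e0 mulr0.
have idM : two_sided_ideal M by split.
(* Since [g] is central, M + g R is a two-sided ideal; it properly contains [M], so it contains
   [e]. *)
have eMg g : g * g = g -> ~ M g -> exists r, M (e - g * r).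
  move=> gg nMg; apply: contrapT => nr; apply: nMg.
  apply: (Pmax [set u | exists r, M (u - g * r)]); last first.
  - by exists 1; rewrite mulr1 subrr.
  - by move=> u Mu; exists 0; rewrite mulr0 subr0.
  split=> [u v [r ur] [s vs]|a u [r ur]|a u [r ur]|//].
  - by exists (r - s); rewrite mulrBr opprD addrACA -opprD; exact: MB.
  - exists (a * r); rewrite mulrA (reduced_idempotent_central a gg) -mulrA -mulrBr.
    exact: Ml.
  - by exists (r * a); rewrite mulrA -mulrBl; exact: Mr.
(* Otherwise [eMg] puts some e - (1 - e) r in [M], and left multiplication by [e] puts [e] there.
   Thus [e] becomes 1 modulo [M]. *)
have M1e : M (1 - e).
  apply: contrapT => nM; have [||r Mr1] := eMg (1 - e) => //.
    by rewrite mulrBl mul1r mulrBr mulr1 ee subrr subr0.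
  apply: Me; have := Ml e _ Mr1.
  by rewrite mulrBr mulrA mulrBr mulr1 ee subrr mul0r subr0.
(* With [g] the idempotent power of [u], write v = (1 - e) v + (e - g r) v + g r v. The last term is
   r g v, a left multiple of u v. *)
have primeM u v : M (u * v) -> M u \/ M v.
  move=> Muv; have [Mu|nMu] := pselect (M u); [by left|right].
  have [d' uE] := reduced_periodic_expr u; pose g := u ^+ d'.+1.
  have ug : u * g = u by rewrite -exprS.
  have gg : g * g = g by rewrite {1}/g exprSr -mulrA ug -exprSr.
  have [|r Mr1] := eMg g gg; first by move=> Mg; apply: nMu; rewrite -ug; exact: Ml.
  rewrite -[v]mul1r -[1](subrK e) mulrDl; apply: (idealD idM); first exact: Mr.
  rewrite -[e](subrK (g * r)) mulrDl; apply: (idealD idM); first exact: Mr.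
  rewrite (reduced_idempotent_central r gg) -mulrA /g exprSr -mulrA.
  by apply/Ml/Ml.
pose Q := quot idM.
have Q1 : (1 : Q) != 0.
  by apply/eqP => /(quot_pi_eq0 idM) M1; apply: Me; rewrite -[e]mulr1; exact: Ml.
pose D : nzRingType := HB.pack Q (GRing.PzSemiRing_isNonZero.Build Q Q1).
have domD : GRing.integral_domain_axiom D.
  elim/quot_ind => u; elim/quot_ind => v.
  rewrite -[_ * _](rmorphM (quot_pi idM)) => /quot_pi_eq0/primeM.
  by case=> /(quot_pi_eq0 idM) ->; rewrite eqxx ?orbT.
have perD : periodic D.
  elim/quot_ind => u; have [m [n [m0 n0 mn uE]]] := perR u.
  by exists m, n; split=> //; rewrite -!(rmorphXn (quot_pi idM)) uE.
have := periodic_domain_mulC domD perD (quot_pi idM x) (quot_pi idM y).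
rewrite -!(rmorphM (quot_pi idM)) => /quot_piP Mz.
by case: Me; rewrite /e exprSr; exact: Ml.
Qed.
End ReducedPeriodic.

Lemma periodic_commutator_nil (R : pzRingType) :
    periodic R -> two_sided_ideal (@Defs.Nil R) ->
  forall x y : R, Defs.Nil (x * y - y * x).
Proof.
move=> perR idN x y; apply/(quot_piP idN); rewrite !rmorphM /=.
apply: reduced_periodic_mulC => [|u n].
  elim/quot_ind => u; have [m [n [m0 n0 mn uE]]] := perR u.
  by exists m, n; split=> //; rewrite -!rmorphXn uE.
elim/quot_ind: u => u; rewrite -rmorphXn => /quot_pi_eq0[k uk].
by apply/quot_pi_eq0; exists (n * k)%N; rewrite exprM.
Qed.
(** * Lifting periodicity modulo nilpotents *)

Lemma periodic_mod_nil (R : pzRingType) (c : nat) (x : R) (m n : nat) :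
    (0 < c)%N -> c%:R = 0 :> R -> (m < n)%N -> Defs.Nil (x ^+ m - x ^+ n) ->
  periodic_elt x.
Proof.
move=> c_gt0 c0 mn [k nuk]; set nu := _ - _ in nuk.
(* c divides the binomial M choose i for 0 < i <= k, so only the first term of
   (x ^+ n + nu) ^+ M survives. *)
pose M := (c * k`!)%N; have M_gt0 : (0 < M)%N by rewrite muln_gt0 c_gt0 fact_gt0.
apply: (@ltn_periodic _ x (m * M) (n * M)); first by rewrite ltn_mul2r M_gt0.
have -> : x ^+ (m * M) = (x ^+ n + nu) ^+ M by rewrite exprM /nu addrC subrK.
rewrite exprM exprDn_comm; last first.
  by apply: commrB; rewrite /GRing.comm // -!exprD addnC.
rewrite big_ord_recl subn0 expr0 mulr1 bin0 mulr1n big1 ?addr0 // => i _.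
rewrite lift0; case: (leqP k i.+1) => [le_ki|lt_ik].
  by rewrite -(subnK le_ki) [nu ^+ _]exprD nuk !mulr0 mul0rn.
(* As i + 1 divides k!, the identity (i + 1) C(M, i + 1) = M C(M - 1, i) exhibits [c] as a factor of
   the binomial. *)
have [q qE] : exists q, k`! = (q * i.+1)%N by apply/dvdnP/dvdn_fact/ltnW.
have -> : 'C(M, i.+1) = (c * (q * 'C(M.-1, i)))%N.
  apply/eqP; rewrite -(eqn_pmul2l (ltn0Sn i)) -mul_bin_diag {1}/M qE.
  by apply/eqP; rewrite !mulnA; congr (_ * _)%N; rewrite -[RHS]mulnA [RHS]mulnC.
by rewrite mulrnA -(mulr_natr _ c) c0 mulr0 mul0rn.
Qed.

(** * The nil ideal of the tensor product *)

Section TensorIdeals.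
Variables (k : comPzRingType) (A B : pzAlgType k).

Lemma tens0l (b : B) : tens (0 : A) b = 0.
Proof. by rewrite -(ascale0 (0 : A)) tensZl ascale0. Qed.

Lemma tens0r (a : A) : tens a (0 : B) = 0.
Proof. by rewrite -(ascale0 (0 : B)) tensZr ascale0. Qed.

Lemma tensNl (a : A) (b : B) : tens (- a) b = - tens a b.
Proof. by symmetry; exact: (tens_oppE [:: (a, b)]). Qed.

Lemma tensNr (a : A) (b : B) : tens a (- b) = - tens a b.
Proof.
by apply/eqP; rewrite -addr_eq0 -tensDr addNr tens0r.
Qed.

Lemma tensX (a : A) (b : B) n : tens a b ^+ n = tens (a ^+ n) (b ^+ n).
Proof. by elim: n => // n IHn; rewrite !exprS IHn tensM. Qed.

Lemma tens_natr n : n%:R = tens n%:R 1 :> tensor A B.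
Proof.
elim: n => [|n IHn]; first by rewrite tens0l.
by rewrite !mulrS tensDl -IHn.
Qed.

Definition tens_span (P : A * B -> Prop) : set (tensor A B) :=
  [set z | exists2 s, (forall p, p \in s -> P p) & z = tens_pi s].

Lemma tens_span_ideal (P : A * B -> Prop) :
    (forall a b, P (a, b) -> P (- a, b)) ->
    (forall p q, P q -> P (p.1 * q.1, p.2 * q.2)) ->
    (forall p q, P p -> P (p.1 * q.1, p.2 * q.2)) ->
  two_sided_ideal (tens_span P).
Proof.
move=> PN Pl Pr; split.
- by exists [::].
- move=> _ _ [s sP ->] [t tP ->]; exists (s ++ tens_map -%R id t).
    move=> p; rewrite mem_cat => /orP[/sP //|/mapP[[a b] /tP Pab ->]].
    exact: PN.
  by rewrite tens_piD -tens_oppE.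
- elim/tens_pi_ind=> t _ [s sP ->]; exists (fmul t s); last by rewrite -tens_mulE.
  by move=> _ /allpairsP[[p q] /= [_ /sP Pq ->]]; exact: Pl.
- elim/tens_pi_ind=> t _ [s sP ->]; exists (fmul s t); last by rewrite -tens_mulE.
  by move=> _ /allpairsP[[p q] /= [/sP Pp _ ->]]; exact: Pr.
Qed.

(** Meant for [f] a projection. The N-th power of a sum of pure tensors is a sum of pure tensors
    whose images under [f] are words of length N in a finite subset of [I]; local nilpotence kills
    all of them for some N. *)
Lemma tens_span_nil (C : pzRingType) (f : A * B -> C) (I : set C) :
    locally_nilpotent I -> f (1, 1) = 1 ->
    (forall p q, f (p.1 * q.1, p.2 * q.2) = f p * f q) ->
    (forall p, f p = 0 -> tens p.1 p.2 = 0) ->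
  forall z, tens_span (fun p => I (f p)) z -> Defs.Nil z.
Proof.
move=> nilI f1 fM f0 _ [s sI ->].
have [|N NP] := nilI [seq f p | p <- s].
  by move=> _ /mapP[p /sI Ip ->].
exists N; have [u uP ->] : exists2 u, (forall p, p \in u -> exists2 w : seq C,
    size w = N /\ {subset w <= [seq f p | p <- s]} & f p = \prod_(x <- w) x)
    & tens_pi s ^+ N = tens_pi u.
  elim: N {NP} => [|N [u uP IHu]].
    exists [:: (1, 1)] => // p; rewrite inE => /eqP ->.
    by exists [::]; rewrite ?big_nil.
  exists (fmul s u); last by rewrite exprS IHu -tens_mulE.
  move=> _ /allpairsP[[p q] /= [sp /uP[w [sw ws] fq] ->]].
  exists (f p :: w); last by rewrite big_cons fM fq.
  split=> [|x /=]; first by rewrite /= sw.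
  by rewrite in_cons => /orP[/eqP ->|/ws //]; exact: map_f.
have {}uP : forall p, p \in u -> tens p.1 p.2 = 0.
  move=> p /uP[w [sw ws] fp]; apply: f0; rewrite fp.
  by move/eqP: sw => sw; exact: (NP (Tuple sw)).
by rewrite tens_sum big_seq big1.
Qed.

Hypotheses (wA : weakly_2primal A) (wB : weakly_2primal B).

Definition tens_nil : set (tensor A B) :=
  tens_span (fun p => Defs.Nil p.1 \/ Defs.Nil p.2).

Lemma tens_nil_ideal : two_sided_ideal tens_nil.
Proof.
case: wA wB => [idA _ _] [idB _ _]; apply: tens_span_ideal.
- by move=> a b [/(idealN idA)|]; [left|right].
- by case: idA idB => [_ _ Il _] [_ _ Il' _] p q [/Il|/Il'] h; [left|right]; exact: h.
- by case: idA idB => [_ _ _ Ir] [_ _ _ Ir'] p q [/Ir|/Ir'] h; [left|right]; exact: h.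
Qed.

(** Split z = x + y, with first components nilpotent in [x] and second ones in [y]. If x^n = 0, then
    z^n vanishes modulo the ideal A (x) N_B, which contains [y] and is nil. *)
Lemma tens_nil_nil z : tens_nil z -> Defs.Nil z.
Proof.
case: wA wB => [idA nilA _] [idB nilB _].
have nil1 := @tens_span_nil _ (fst : A * B -> A) _ nilA erefl (fun _ _ => erefl).
have nil2 := @tens_span_nil _ (snd : A * B -> B) _ nilB erefl (fun _ _ => erefl).
have id2 : two_sided_ideal (tens_span (fun p : A * B => Defs.Nil p.2)).
  apply: tens_span_ideal => [//||].
  - by case: idB => _ _ Il _ p q; exact: Il.
  - by case: idB => _ _ _ Ir p q; exact: Ir.
move=> [s sP ->]; pose isA (p : A * B) := `[< Defs.Nil p.1 >].
have -> : tens_pi s = tens_pi [seq p <- s | isA p] + tens_pi [seq p <- s | ~~ isA p].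
  by rewrite !tens_sum !big_filter [LHS](bigID isA).
set x := tens_pi _; set y := tens_pi _.
have [n xn] : Defs.Nil x.
  apply: nil1 => [[a b] /= ->|]; first exact: tens0l.
  by exists [seq p <- s | isA p] => // p; rewrite mem_filter => /andP[/asboolP].
have [m] : Defs.Nil ((x + y) ^+ n).
  apply: nil2 => [[a b] /= ->|]; first exact: tens0r.
  apply/(quot_pi_eq0 id2); rewrite rmorphXn rmorphD /=.
  have /(quot_pi_eq0 id2) -> : tens_span (fun p : A * B => Defs.Nil p.2) y.
    exists [seq p <- s | ~~ isA p] => // p; rewrite mem_filter.
    by move=> /andP[/asboolPn nA /sP[]].
  by rewrite addr0 -rmorphXn xn rmorph0.
by rewrite -exprM => nm; exists (n * m)%N.
Qed.

(** * Commutativity and periodicity of the quotient by the nil ideal *)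

Hypotheses (perA : periodic A) (perB : periodic B).

Lemma tens_quot_mulC (u v : quot tens_nil_ideal) : u * v = v * u.
Proof.
case: wA wB => [idA _ _] [idB _ _].
elim/quot_ind: u; elim/tens_pi_ind=> s; elim/quot_ind: v; elim/tens_pi_ind=> t.
rewrite !tens_sum !rmorph_sum /= mulr_suml mulr_sumr; apply: eq_bigr => -[a b] _.
rewrite mulr_suml mulr_sumr; apply: eq_bigr => -[a' b'] _ /=.
rewrite -!rmorphM /= !tensM; apply/quot_piP.
(* The commutator of two pure tensors is [a, a'] (x) b b' + a' a (x) [b, b']. *)
exists [:: (a * a' - a' * a, b * b'); (a' * a, b * b' - b' * b)].
  move=> p /[!inE] /orP[]/eqP ->; [left|right] => /=;
    exact: periodic_commutator_nil.
by rewrite tens_sum big_cons big_seq1 /= tensDl tensDr tensNl tensNr subrKA.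
Qed.

Lemma tens_quot_periodic : periodic (quot tens_nil_ideal).
Proof.
have [c c_gt0 c0] := periodic_char perA.
have cQ : c%:R = 0 :> quot tens_nil_ideal.
  rewrite -[1](rmorph1 (quot_pi tens_nil_ideal)) -rmorphMn /= tens_natr c0.
  by rewrite tens0l rmorph0.
elim/quot_ind; elim/tens_pi_ind=> s; rewrite tens_sum rmorph_sum /=.
elim/big_rec: _ => [|[a b] z _ perz]; first by exists 1%N, 2%N; rewrite !expr0n.
apply: (periodicDM c_gt0 cQ (tens_quot_mulC _ _) _ perz).1 => /=.
have -> : tens a b = tens a 1 * tens 1 b by rewrite tensM mulr1 mul1r.
rewrite rmorphM /=; apply: (periodicDM c_gt0 cQ (tens_quot_mulC _ _) _ _).2.
  have [m [n [m0 n0 mn aE]]] := perA a; exists m, n; split=> //.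
  by rewrite -!rmorphXn /= !tensX aE !expr1n.
have [m [n [m0 n0 mn bE]]] := perB b; exists m, n; split=> //.
by rewrite -!rmorphXn /= !tensX bE !expr1n.
Qed.

End TensorIdeals.

Theorem theorem4p2 (k : comPzRingType) (A B : pzAlgType k) :
  weakly_2primal A -> periodic A ->
  weakly_2primal B -> periodic B ->
  periodic (tensor A B).
Proof.
move=> wA perA wB perB x; have [c c_gt0 c0] := periodic_char perA.
have cT : c%:R = 0 :> tensor A B.
  by rewrite tens_natr c0 tens0l.
have [m [n [_ mn xE]]] :=
  periodic_ltn (tens_quot_periodic perA perB (quot_pi (tens_nil_ideal wA wB) x)).
apply: (periodic_mod_nil c_gt0 cT mn); apply: (tens_nil_nil wA wB).
by apply/(quot_piP (tens_nil_ideal wA wB)); rewrite !rmorphXn.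
Qed.
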